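(* For every simple graph $G$ on $n$ vertices, with complement $\overline{G}$, \[\lambda_1(G)+\lambda_1(\overline{G})\le \frac43 n-1.\]
   Context: Graphs here are finite, simple and undirected (no loops), and $\overline{G}$ is the usual complement. $\lambda_1(G)$ denotes the largest eigenvalue of the adjacency matrix of $G$. *)

(* Defs.v *)
From HB Require Import structures.
From mathcomp Require Import all_boot all_order all_algebra.
From mathcomp Require Import classical_sets reals.

Set Implicit Arguments.
Unset Strict Implicit.
Unset Printing Implicit Defensive.

Import Order.TTheory GRing.Theory Num.Theory.

Local Open Scope ring_scope.

Record sgraph := SGraph {
  vertex :> finType;
  adj : rel vertex;
  adj_sym : symmetric adj;
  adj_irr : irreflexive adj }.

Section Complement.
Variable G : sgraph.

Definition compl_adj : rel G := fun x y => (x != y) && ~~ adj x y.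

Fact compl_adj_sym : symmetric compl_adj.
Proof. by move=> x y; rewrite /compl_adj eq_sym adj_sym. Qed.

Fact compl_adj_irr : irreflexive compl_adj.
Proof. by move=> x; rewrite /compl_adj eqxx. Qed.

Definition compl : sgraph := SGraph compl_adj_sym compl_adj_irr.

End Complement.

Definition adjmx (R : realType) (G : sgraph) : 'M[R]_#|G| :=
  \matrix_(i, j) (adj (enum_val i) (enum_val j))%:R.

(* When G has a vertex, the adjacency matrix is real symmetric of positive
   size, so its set of eigenvalues is finite and nonempty and this supremum is
   the maximum.  On the graph without vertices it has the junk value
   sup set0 = 0. *)
Definition lambda1 (R : realType) (G : sgraph) : R :=
  sup [set a : R | eigenvalue (adjmx R G) a]%classic.

(* Main.v *)
(* Write x, y for the absolute values of unit eigenvectors of G and of its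
   complement.  The two eigenvalues add up to at most
   sum_(i,j) max (x_i x_j, y_i y_j) - 1.  The maximum is x_i x_j along the row
   of a vertex with extreme ratio x_i / y_i, or y_i y_j along the whole row;
   removing such vertices one by one replaces G by a threshold graph with loops.

   If a and b are below the Rayleigh quotients of x and y, completing the square
   at each removed vertex keeps the form a |x|^2 - <Tx,x> - r/(1-r) (sum x)^2
   negative while r, which starts at 0, follows r -> r + 1/a or
   1/r -> 1/r - 1/a; a coefficient s does the same for b and y with the two
   moves exchanged.  Both must reach 1.  The continuous-time version is an
   optimal control problem whose optimal paths switch once; its value function is
   the minimum of b s + a^2 r / (a + b r s) and of its mirror image.  It grows by
   at most 1 per vertex, so n >= (a^2 + a b + b^2) / (a + b) >= 3/4 (a + b). *)
Require Import Defs.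
From HB Require Import structures.
From mathcomp Require Import all_boot all_order all_algebra.
From mathcomp Require Import classical_sets reals.
From mathcomp Require Import ring lra.

Set Implicit Arguments.
Unset Strict Implicit.
Unset Printing Implicit Defensive.

Import Order.TTheory GRing.Theory Num.Theory.

Local Open Scope ring_scope.

(** * Growth of the potential in one move *)

Section Potential.
Variable R : realFieldType.
Implicit Types a b r s t : R.

Definition half_potential a b r s := b * s + a ^+ 2 * r / (a + b * r * s).
Definition potential a b r s :=
  Num.min (half_potential a b r s) (half_potential b a s r).

Lemma potentialC a b r s : potential a b r s = potential b a s r.
Proof. exact: minC. Qed.

Lemma den_gt0 a b r s : 0 < a -> 0 < b -> 0 <= r -> 0 <= s -> 0 < a + b * r * s.
Proof. by move=> a0 b0 r0 s0; rewrite ltr_pwDl// !mulr_ge0// ltW. Qed.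

Definition damping a b r s r' s' :=
  a ^+ 2 / ((a + b * r * s) * (a + b * r' * s')).

Lemma damping_bounds a b r s r' s' : 0 < a -> 0 < b -> 0 <= r -> 0 <= s ->
  0 <= r' -> 0 <= s' -> 0 <= damping a b r s r' s' <= 1.
Proof.
move=> a0 b0 r0 s0 r'0 s'0; have D := den_gt0 a0 b0 r0 s0.
have D' := den_gt0 a0 b0 r'0 s'0.
rewrite /damping divr_ge0 ?ler_pdivrMr ?mulr_gt0 ?sqr_ge0 ?mul1r//=.
  by rewrite expr2 ler_pM ?lerDl ?mulr_ge0// ltW.
by rewrite ltW// mulr_gt0.
Qed.

Lemma half_potential_incr a b r s r' s' : 0 < a -> 0 < b -> 0 <= r -> 0 <= s ->
  0 <= r' -> 0 <= s' ->
  half_potential a b r' s' - half_potential a b r s =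
  b * (s' - s) +
  damping a b r s r' s' * (a * (r' - r) - r * r' * (b * (s' - s))).
Proof.
move=> a0 b0 r0 s0 r'0 s'0; have D := lt0r_neq0 (den_gt0 a0 b0 r0 s0).
have D' := lt0r_neq0 (den_gt0 a0 b0 r'0 s'0).
by rewrite /half_potential /damping; field; rewrite D D'.
Qed.

(** With k the damping and q = r r', the increment is (1 - k q) d + k t where d <= 1 and t <= q,
    hence at most (1 - k q) + k q = 1. *)
Lemma half_potential_up a b r s r' s' : 0 < a -> 0 < b ->
  0 <= r -> 0 <= s -> 0 <= r' <= 1 -> 0 <= s' ->
  r <= 1 -> b * (s' - s) <= 1 -> a * (r' - r) <= r * r' ->
  half_potential a b r' s' <= half_potential a b r s + 1.
Proof.
move=> a0 b0 r0 s0 /andP[r'0 r'1] s'0 r1 hs hr; rewrite -lerBlDl.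
rewrite half_potential_incr//.
have /andP[k0 k1] := damping_bounds a0 b0 r0 s0 r'0 s'0.
move: (damping _ _ _ _ _ _) k0 k1 => k k0 k1.
move: (a * (r' - r)) (b * (s' - s)) hr hs => t d ht hd.
have q1 : r * r' <= 1 by rewrite mulr_ile1.
have q0 : 0 <= r * r' by rewrite mulr_ge0.
move: (r * r') q0 q1 ht => q q0 q1 ht.
have : k * t <= k * q by rewrite ler_wpM2l.
have : (1 - k * q) * d <= (1 - k * q) * 1.
  by rewrite ler_wpM2l// subr_ge0 mulr_ile1.
lra.
Qed.

(* The left-hand side of [low] minus its right-hand side has the sign of
   the difference of the two halves of the potential. *)
Lemma half_potential_low a b r s t r' s' : 0 < a -> 0 < b ->
  0 <= r -> 0 <= s -> 0 <= t -> r <= 1 -> 0 <= r' <= 1 -> 0 <= s' ->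
  forall low : a * s * (1 - r ^+ 2) <= b * r * (1 - s ^+ 2),
  a * (r' - r) = t -> b * (s' - s) = t * (s * s') ->
  half_potential a b r' s' <= half_potential a b r s + t.
Proof.
move=> a0 b0 r0 s0 t0 r1 /andP[r'0 r'1] s'0 low hr hs; rewrite -lerBlDl.
rewrite half_potential_incr// hr hs.
have rr : r * r' <= 1 by rewrite mulr_ile1.
(* Multiply [low] by s'. Replacing r^2 by r r' and s^2 by s s' then changes both sides by the same r
   t s s'. *)
have key : a * (s * s') * (1 - r * r') <= b * (r * s) * (1 - s * s').
  have : s' * (a * s * (1 - r ^+ 2)) <= s' * (b * r * (1 - s ^+ 2)).
    exact: ler_wpM2l.
  have -> : a * (s * s') * (1 - r * r') =
     s' * (a * s * (1 - r ^+ 2)) - r * (a * (r' - r) * (s * s')) by ring.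
  rewrite hr -hs.
  have -> : b * (r * s) * (1 - s * s') =
     s' * (b * r * (1 - s ^+ 2)) - r * (b * (s' - s)) by ring.
  lra.
have ss1 : s * s' <= 1.
  have [->|s_neq0] := eqVneq s 0; first by rewrite mul0r ler01.
  have s_gt0 : 0 < s by rewrite lt_def s_neq0.
  have r_gt0 : 0 < r.
    rewrite lt_def r0 andbT; apply: contraTneq low => ->.
    by rewrite mulr0 mul0r expr0n subr0 mulr1 -ltNge mulr_gt0.
  have : 0 <= b * (r * s) * (1 - s * s').
    by apply: le_trans key; rewrite !mulr_ge0 ?subr_ge0// ltW.
  by rewrite pmulr_rge0 ?subr_ge0// !mulr_gt0.
have D := den_gt0 a0 b0 r0 s0; have D' := den_gt0 a0 b0 r'0 s'0.
set k := damping _ _ _ _ _ _.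
have kE : k * ((a + b * r * s) * (a + b * r' * s')) = a ^+ 2.
  by rewrite /k /damping divfK// mulf_neq0 ?lt0r_neq0.
(* The increment is t times k + s s' (1 - k r r'). *)
suff : s * s' * (1 - k * (r * r')) <= 1 - k.
  move=> /(ler_wpM2l t0); lra.
have DD := mulr_gt0 D D'.
rewrite -(ler_pM2r DD).
have -> : s * s' * (1 - k * (r * r')) * ((a + b * r * s) * (a + b * r' * s')) =
   s * s' * ((a + b * r * s) * (a + b * r' * s') - a ^+ 2 * (r * r')).
  rewrite -kE; ring.
rewrite mulrBl mul1r kE.
have : 0 <= a * (b * (r * s) * (1 - s * s') - a * (s * s') * (1 - r * r')).
  by rewrite mulr_ge0 ?subr_ge0// ltW.
have : 0 <= (1 - s * s') * (b * r' * s') * (a + b * r * s).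
  by rewrite !mulr_ge0 ?subr_ge0// ltW.
lra.
Qed.

(** It suffices to control the half that is smaller at the start. The mirrored half is covered by
    [half_potential_up], the other one by [half_potential_low]. *)
Lemma potential_step a b r s r' s' : 0 < a -> 0 < b ->
  0 <= r -> 0 <= s -> r <= r' <= 1 -> s <= s' <= 1 ->
  a * (r' - r) <= 1 -> b * (s' - s) <= s * s' ->
  potential a b r' s' <= potential a b r s + 1.
Proof.
move=> a0 b0 r0 s0 /andP[rr' r'1] /andP[ss' s'1] hr hs.
have r'0 : 0 <= r' by apply: le_trans rr'.
have s'0 : 0 <= s' by apply: le_trans ss'.
have r1 : r <= 1 by apply: le_trans r'1.
have s1 : s <= 1 by apply: le_trans s'1.
have up : half_potential b a s' r' <= half_potential b a s r + 1.
  by apply: half_potential_up => //; rewrite s'0.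
rewrite /potential; have [low|high] :=
    leP (a * s * (1 - r ^+ 2)) (b * r * (1 - s ^+ 2)); last first.
  rewrite (min_idPr (_ : half_potential b a s r <= half_potential a b r s)).
    by rewrite ge_min up orbT.
  rewrite -subr_ge0 /half_potential.
  have D := den_gt0 a0 b0 r0 s0; have D' := den_gt0 b0 a0 s0 r0.
  have -> : b * s + a ^+ 2 * r / (a + b * r * s) -
      (a * r + b ^+ 2 * s / (b + a * s * r)) =
    a * b * r * s * (a * s * (1 - r ^+ 2) - b * r * (1 - s ^+ 2)) /
      ((a + b * r * s) * (b + a * s * r)).
    by field; rewrite !lt0r_neq0.
  by rewrite divr_ge0 ?mulr_ge0 ?subr_ge0 ?(ltW high)// ltW.
suff low' : half_potential a b r' s' <= half_potential a b r s + 1.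
  by rewrite addr_minl le_min !ge_min low' up orbT.
set t := a * (r' - r) in hr *.
have t0 : 0 <= t by rewrite mulr_ge0 ?subr_ge0// ltW.
(* As r' <= 1, t s (1 + r) <= a s (1 - r^2), which [low] bounds by b r < b (1 + r). So the
   reciprocal move of s has no pole up to time t. *)
have tsb : t * s < b.
  have r10 : 0 < 1 + r by rewrite ltr_pwDl.
  rewrite -(ltr_pM2r r10).
  have : a * (1 - r') * (s * (1 + r)) >= 0.
    by rewrite !mulr_ge0 ?subr_ge0// ?(ltW a0)// ltW.
  have : 0 <= b * r * s ^+ 2 by rewrite !mulr_ge0 ?sqr_ge0// ltW.
  by move: low; rewrite /t; lra.
have tsb0 : 0 < b - t * s by rewrite subr_gt0.
(* If [r'] is clamped at [1], then [r] moves only for the time [t <= 1]; [s2] is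
   the position of the other coordinate at that time. *)
pose s2 := b * s / (b - t * s).
have s20 : 0 <= s2 by rewrite /s2 divr_ge0 ?mulr_ge0// ltW.
have s2E : b * (s2 - s) = t * (s * s2).
  by rewrite /s2; field; rewrite lt0r_neq0.
have core : half_potential a b r' s2 <= half_potential a b r s + t.
  by apply: half_potential_low => //; rewrite r'0.
suff : half_potential a b r' s' - half_potential a b r' s2 <= 1 - t by lra.
rewrite half_potential_incr// subrr mulr0 sub0r.
have /andP[k0 k1] := damping_bounds a0 b0 r'0 s20 r'0 s'0.
move: (damping _ _ _ _ _ _) k0 k1 => k k0 k1.
set d := b * (s' - s2).
have -> : d + k * - (r' * r' * d) = (1 - k * (r' * r')) * d by ring.
have kk : 0 <= k * (r' * r') <= 1.
  by rewrite !mulr_ge0//= !mulr_ile1 ?mulr_ge0.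
have [d0|d0] := leP d 0.
  by apply: (@le_trans _ _ 0); [rewrite mulr_ge0_le0// subr_ge0|]; lra.
have s2s' : s2 < s' by move: d0; rewrite pmulr_rgt0// subr_gt0.
apply: (@le_trans _ _ d); first by rewrite ler_piMl ?(ltW d0)//; lra.
have s_gt0 : 0 < s.
  rewrite lt_def s0 andbT; apply: contraTneq hs => ->.
  by rewrite mul0r subr0 -ltNge mulr_gt0// (le_lt_trans s20).
(* In reciprocals: b/s - b/s' <= 1 and b/s - b/s2 = t, so b/s2 - b/s' <= 1 - t. *)
have : s * d <= s * ((1 - t) * (s' * s2)).
  have := ler_wpM2l s20 hs; have : s' * (b * (s2 - s)) = s' * (t * (s * s2)).
    by rewrite s2E.
  rewrite /d; lra.
rewrite ler_pM2l// => /le_trans; apply.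
by rewrite ler_piMr ?subr_ge0// mulr_ile1// ltW// (lt_le_trans s2s').
Qed.

End Potential.

(** * Quadratic forms of threshold words *)

Section Threshold.
Variable R : realFieldType.
Implicit Types (a b r s t x y : R) (l : seq (bool * R)).

(* A word in [bool] describes a threshold graph with loops: a letter [true]
   is a vertex joined to itself and to all later ones, a letter [false] a
   vertex joined to no later one.  [tform] is the quadratic form of its
   adjacency matrix. *)
Fixpoint tform l : R :=
  if l is (d, x) :: l' then
    (if d then x ^+ 2 + 2 * x * \sum_(p <- l') p.2 else 0) + tform l'
  else 0.

(** Cauchy-Schwarz for the sum runs along in the induction, as it bounds the cross term 2 x X. This
    crude bound serves words where one of the two forms is nonpositive. *)
Lemma tform_le l : tform l <= (size l)%:R * \sum_(p <- l) p.2 ^+ 2.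
Proof.
suff [] : (\sum_(p <- l) p.2) ^+ 2 <= (size l)%:R * \sum_(p <- l) p.2 ^+ 2 /\
  tform l <= (size l)%:R * \sum_(p <- l) p.2 ^+ 2 by [].
elim: l => [|[d x] l [IH1 IH2]] /=; first by rewrite !big_nil mulr0 expr0n.
rewrite !big_cons /= -[(size l).+1]addn1 natrD.
have S0 : 0 <= \sum_(p <- l) p.2 ^+ 2 by apply: sumr_ge0 => p _; exact: sqr_ge0.
case: l IH1 IH2 S0 => [|q l].
  by rewrite !big_nil /= => _ _ _; have := sqr_ge0 x; split; case: d; lra.
set X := \sum_(p <- _) p.2; set S := \sum_(p <- _) _ ^+ 2; set Q := tform _.
have : 0 < (size (q :: l))%:R :> R by rewrite ltr0n.
move: (size _)%:R => m m0 IH1 IH2 S0.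
have h : 2 * x * X <= m * x ^+ 2 + S.
  rewrite -(ler_pM2l m0); have := sqr_ge0 (m * x - X); lra.
have x2 := sqr_ge0 x; have mx2 := mulr_ge0 (ltW m0) x2.
by split; [|case: d]; lra.
Qed.

(* [live a r l] says that the form [a |x|^2 - tform - r / (1 - r) (sum x)^2]
   is negative; [r = 1] stands for an infinite coefficient. *)
Definition live a r l := r < 1 ->
  (1 - r) * (a * \sum_(p <- l) p.2 ^+ 2 - tform l) < r * (\sum_(p <- l) p.2) ^+ 2.

(** The coefficient left after minimising the form over the removed entry x. For r < 1 the
    coefficient of x^2 is a - 1/(1 - r) for [true] and a - r/(1 - r) for [false]; where it is not
    positive, the value is 1. *)
Definition next a r (d : bool) :=
  if d then Num.min 1 (r + a^-1)
  else if (a + 1) * r < a then a * r / (a - r) else 1.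

Lemma live_next a r d x l : 0 < a -> 0 <= r -> live a r ((d, x) :: l) ->
  live a (next a r d) l.
Proof.
move=> a0 r0; rewrite /live /= !big_cons /=.
set X := \sum_(p <- _) p.2; set S := \sum_(p <- _) _ ^+ 2; set Q := tform _.
case: d => /= H; last first.
  case: ifPn => [ra _|]; last by rewrite ltxx.
  have r1 : r < 1 by rewrite -(ltr_pM2l a0); lra.
  have ar : 0 < a - r by have := mulr_ge0 (ltW a0) r0; lra.
  have {}H := H r1.
  have -> : 1 - a * r / (a - r) = (a - (a + 1) * r) / (a - r).
    by field; rewrite lt0r_neq0.
  rewrite mulrAC [ltRHS]mulrAC ltr_pM2r ?invr_gt0//.
  rewrite -(@ltr_pM2l _ (1 - r)) ?subr_gt0//.
  have A0 : 0 < a - (a + 1) * r by lra.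
  rewrite -(ltr_pM2l A0) in H.
  have := sqr_ge0 ((a - (a + 1) * r) * x - r * X).
  lra.
rewrite gt_min ltxx /= => ra.
have ai : 0 < a^-1 by rewrite invr_gt0.
have r1 : r < 1 by lra.
have {}H := H r1.
rewrite (min_idPr _) ?(ltW ra)//.
have g0 : 0 < 1 - (r + a^-1) by lra.
rewrite -(ltr_pM2l g0) in H; rewrite -(@ltr_pM2l _ (1 - r)) ?subr_gt0//.
have : 0 <= a^-1 * (X - a * (1 - (r + a^-1)) * x) ^+ 2.
  by rewrite mulr_ge0 ?sqr_ge0// ltW.
have -> : a^-1 * (X - a * (1 - (r + a^-1)) * x) ^+ 2 =
    (1 - r) * X ^+ 2 - (1 - (r + a^-1)) * (x + X) ^+ 2 +
    (1 - r) * (1 - (r + a^-1)) * (a * x ^+ 2).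
  by field; rewrite lt0r_neq0.
lra.
Qed.

Lemma next_bounds a r d : 0 < a -> 0 <= r <= 1 -> r <= next a r d <= 1.
Proof.
move=> a0 /andP[r0 r1]; have ai : 0 < a^-1 by rewrite invr_gt0.
case: d => /=; first by rewrite le_min r1 ge_min lexx lerDl ltW.
case: ifPn => [ra|_]; last by rewrite r1 lexx.
have ar : 0 < a - r by have := mulr_ge0 (ltW a0) r0; lra.
rewrite ler_pdivlMr// ler_pdivrMr//; apply/andP; split; last by lra.
by rewrite mulrC ler_wpM2r// gerBl.
Qed.

Lemma next_true a r : 0 < a -> a * (next a r true - r) <= 1.
Proof.
move=> a0 /=; rewrite -ler_pdivlMl// mulr1 lerBlDl.
by rewrite ge_min lexx orbT.
Qed.

Lemma next_false a r : 0 < a -> 0 <= r <= 1 ->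
  a * (next a r false - r) <= r * next a r false.
Proof.
move=> a0 /andP[r0 r1] /=; case: ifPn => [ra|]; last by rewrite -leNgt; lra.
have ar : 0 < a - r by have := mulr_ge0 (ltW a0) r0; lra.
suff -> : a * (a * r / (a - r) - r) = r * (a * r / (a - r)) by [].
by field; rewrite lt0r_neq0.
Qed.

Lemma potential_next a b r s d : 0 < a -> 0 < b -> 0 <= r <= 1 -> 0 <= s <= 1 ->
  potential a b (next a r d) (next b s (~~ d)) <= potential a b r s + 1.
Proof.
move=> a0 b0 r01 s01; have [/andP[r0 _] /andP[s0 _]] := (r01, s01).
case: d; first exact: potential_step (next_bounds true a0 r01)
  (next_bounds false b0 s01) (next_true r a0) (next_false b0 s01).
rewrite potentialC [potential a b _ _]potentialC.
exact: potential_step (next_bounds true b0 s01) (next_bounds false a0 r01)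
  (next_true s b0) (next_false a0 r01).
Qed.

Definition word := seq (bool * (R * R)).
Implicit Type w : word.
Definition fst_word w := [seq (p.1, p.2.1) | p <- w].
Definition snd_word w := [seq (~~ p.1, p.2.2) | p <- w].

Lemma potential_live a b r s w : 0 < a -> 0 < b -> 0 <= r <= 1 -> 0 <= s <= 1 ->
  live a r (fst_word w) -> live b s (snd_word w) ->
  potential a b 1 1 <= potential a b r s + (size w)%:R.
Proof.
move=> a0 b0; elim: w r s => [|[d [x y]] w IH] r s r01 s01 /= Lx Ly.
  (* On the empty word both sides of the strict inequality in [live] are 0, so t < 1 is
     impossible. *)
  have end1 c t : 0 <= t <= 1 -> live c t [::] -> t = 1.
    move=> /andP[t0 t1]; rewrite /live !big_nil/= subr0 mulr0 expr0n !mulr0 ltxx.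
    by move=> H; apply/eqP; rewrite eq_le t1 leNgt; apply/negP => /H.
  by rewrite (end1 _ _ r01 Lx) (end1 _ _ s01 Ly) addr0.
have r0 : 0 <= r by case/andP: r01.
have s0 : 0 <= s by case/andP: s01.
have /andP[nr0 nr1] := next_bounds d a0 r01.
have /andP[ns0 ns1] := next_bounds (~~ d) b0 s01.
have := IH _ _ _ _ (live_next a0 r0 Lx) (live_next b0 s0 Ly).
rewrite nr1 ns1 (le_trans r0)// (le_trans s0)// => /(_ isT isT) /le_trans; apply.
by rewrite -[(size w).+1]add1n natrD addrA lerD2r potential_next.
Qed.

Lemma word_bound w :
  \sum_(p <- w) p.2.1 ^+ 2 = 1 -> \sum_(p <- w) p.2.2 ^+ 2 = 1 ->
  tform (fst_word w) + tform (snd_word w) <= 4 / 3 * (size w)%:R.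
Proof.
move=> x1 y1.
have X1 : \sum_(p <- fst_word w) p.2 ^+ 2 = 1 by rewrite big_map.
have Y1 : \sum_(p <- snd_word w) p.2 ^+ 2 = 1 by rewrite big_map.
have := tform_le (fst_word w); have := tform_le (snd_word w).
rewrite X1 Y1 !size_map mulr1.
set A := tform (fst_word w); set B := tform (snd_word w) => Bn An.
have n0 : 0 <= (size w)%:R :> R by [].
have [A0|A0] := leP A 0; first lra.
have [B0|B0] := leP B 0; first lra.
have bound a b : 0 < a < A -> 0 < b < B -> a + b <= 4 / 3 * (size w)%:R.
  move=> /andP[a0 aA] /andP[b0 bB].
  have c01 : 0 <= (0 : R) <= 1 by rewrite lexx ler01.
  have := @potential_live a b 0 0 w a0 b0 c01 c01.
  rewrite /live X1 Y1 subr0 !mul1r !mul0r !mulr1 !subr_lt0 -/A -/B.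
  move=> /(_ (fun=> aA) (fun=> bB)); apply: contraTT; rewrite -!ltNge => nab.
  have ab0 : 0 < a + b by rewrite addr_gt0.
  have p0 : potential a b 0 0 = 0.
    by rewrite /potential /half_potential !(mulr0, mul0r) addr0 minxx.
  rewrite p0 add0r; apply: (@lt_le_trans _ _ (3 / 4 * (a + b))); first lra.
  (* Both halves equal (a^2 + a b + b^2) / (a + b), which exceeds 3/4 (a + b) by (a - b)^2 / (4 (a +
     b)). *)
  rewrite /potential /half_potential !mulr1.
  rewrite le_min; apply/andP; split; rewrite -lerBlDl ler_pdivlMr ?addr_gt0//;
    have := sqr_ge0 (a - b); lra.
rewrite leNgt; apply/negP => AB.
(* Halves keep A - e and B - e positive; a third of the excess makes the total loss 2 e smaller than
   the excess. *)
pose e := Num.min (Num.min (A / 2) (B / 2)) ((A + B - 4 / 3 * (size w)%:R) / 3).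
have e0 : 0 < e by rewrite !lt_min !divr_gt0// subr_gt0.
have eA : e <= A / 2 by rewrite !ge_min lexx.
have eB : e <= B / 2 by rewrite !ge_min lexx orbT.
have eAB : e <= (A + B - 4 / 3 * (size w)%:R) / 3 by rewrite !ge_min lexx !orbT.
have := bound (A - e) (B - e); lra.
Qed.

(** * Reduction of the maximum form to a word *)

Lemma seq_argmin (T : eqType) (f : T -> R) (s : seq T) : s != [::] ->
  exists2 d, d \in s & forall p, p \in s -> f d <= f p.
Proof.
elim: s => // p [|q s] IH _.
  by exists p => [|p']; rewrite inE// => /eqP->.
have [d ds dmin] := IH isT; have [pd|dp] := leP (f p) (f d).
  exists p => [|p']; rewrite inE ?eqxx// => /predU1P[->//|/dmin].
  exact: le_trans.
exists d => [|p']; rewrite inE ?ds ?orbT// => /predU1P[->|/dmin//].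
exact: ltW.
Qed.

(* [p] maximises [max (p.1 / p.2) (p.2 / p.1)], so its side of the maximum
   is the same against every [q]. *)
Lemma extreme_pair (s : seq (R * R)) : s != [::] ->
  (forall p, p \in s -> 0 <= p.1 /\ 0 <= p.2) ->
  exists2 p, p \in s & exists d : bool, forall q, q \in s ->
    Num.max (p.1 * q.1) (p.2 * q.2) = if d then p.1 * q.1 else p.2 * q.2.
Proof.
move=> s_neq0 s_ge0.
(* The inverse of the ratio to be maximised: a vanishing entry gives 0, and so does the pair (0, 0)
   since 0 / 0 = 0. *)
pose t (p : R * R) := Num.min p.1 p.2 / Num.max p.1 p.2.
have [p ps pmin] := seq_argmin t s_neq0.
exists p => //; exists (p.2 <= p.1) => q qs.
have [p1 p2] := s_ge0 _ ps; have [q1 q2] := s_ge0 _ qs.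
have ratio (x y : R) : 0 <= x -> 0 <= y -> x <= y -> x = x / y * y.
  move=> x0 y0 xy; have [y_0|y_neq0] := eqVneq y 0; last by rewrite divfK.
  by apply/eqP; rewrite y_0 mulr0 eq_le x0 andbT -y_0.
have cmp (x y z u : R) : 0 <= x -> 0 <= y -> 0 <= z -> 0 <= u -> y <= x ->
    y / x <= Num.min z u / Num.max z u -> y * u <= x * z.
  move=> x0 y0 z0 u0 yx; have [zu|uz] := leP z u => tt; last first.
    by rewrite ler_pM// ltW.
  have := ler_wpM2r (mulr_ge0 x0 u0) tt.
  by rewrite mulrA -(ratio y x)// mulrCA -(ratio z u).
have := pmin q qs; rewrite /t; have [yx|xy] := leP p.2 p.1 => tt.
  by rewrite (max_idPl _)// cmp.
rewrite (max_idPr _)//; apply: cmp => //; first exact: ltW.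
by rewrite minC maxC.
Qed.

Lemma word_of_pairs (s : seq (R * R)) :
  (forall p, p \in s -> 0 <= p.1 /\ 0 <= p.2) ->
  exists2 w : word, perm_eq [seq p.2 | p <- w] s &
  \sum_(p <- s) \sum_(q <- s) Num.max (p.1 * q.1) (p.2 * q.2) =
  tform (fst_word w) + tform (snd_word w).
Proof.
move: {2}(size s) (erefl (size s)) => n; elim: n s => [|n IH] s sz s_ge0.
  by rewrite (size0nil sz); exists [::] => //; rewrite !big_nil addr0.
have s_neq0 : s != [::] by rewrite -size_eq0 sz.
have [p ps [d pE]] := extreme_pair s_neq0 s_ge0.
have ss := perm_to_rem ps; set s' := rem p s in ss.
have s's q : q \in s' -> q \in s by exact: mem_rem.
have sz' : size s' = n by rewrite size_rem// sz.
have [w ws wE] := IH s' sz' (fun q qs => s_ge0 q (s's q qs)).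
exists ((d, p) :: w) => /=.
  by rewrite perm_sym (perm_trans ss)// perm_cons perm_sym.
rewrite (perm_big _ ss) /= big_cons (perm_big _ ss) /= big_cons.
under [X in _ + X = _]eq_bigr do rewrite (perm_big _ ss) /= big_cons.
rewrite big_split /= wE !big_map.
have sumE (F : R * R -> R) : \sum_(q <- w) F q.2 = \sum_(q <- s') F q.
  by rewrite -(perm_big _ ws) big_map.
rewrite (sumE fst) (sumE snd).
have rowE : \sum_(q <- s') Num.max (p.1 * q.1) (p.2 * q.2) =
    if d then p.1 * \sum_(q <- s') q.1 else p.2 * \sum_(q <- s') q.2.
  rewrite (eq_big_seq _ (fun q qs => pE q (s's q qs))).
  by case: (d); rewrite mulr_sumr.
(* The column of p equals its row; together they make the cross term of [tform]. *)
under [X in _ + (X + _) = _]eq_bigr do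
  rewrite [_.1 * p.1]mulrC [_.2 * p.2]mulrC.
rewrite rowE pE//; case: (d) => /=; ring.
Qed.

Lemma max_form_bound (s : seq (R * R)) :
  (forall p, p \in s -> 0 <= p.1 /\ 0 <= p.2) ->
  \sum_(p <- s) p.1 ^+ 2 = 1 -> \sum_(p <- s) p.2 ^+ 2 = 1 ->
  \sum_(p <- s) \sum_(q <- s) Num.max (p.1 * q.1) (p.2 * q.2) <=
  4 / 3 * (size s)%:R.
Proof.
move=> s_ge0 x1 y1; have [w ws ->] := word_of_pairs s_ge0.
rewrite -(perm_size ws) size_map; apply: word_bound.
  by rewrite -x1 -(perm_big _ ws) big_map.
by rewrite -y1 -(perm_big _ ws) big_map.
Qed.

End Threshold.

(** * From eigenvalues to quadratic forms *)

Section Rayleigh.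
Variables (R : realType) (G : sgraph).
Let N := #|G|.

Definition rayleigh (A : 'M[R]_N) (v : 'I_N -> R) :=
  \sum_i \sum_j A i j * (v i * v j).

Lemma adjmx_diag (H : sgraph) i : adjmx R H i i = 0.
Proof. by rewrite mxE adj_irr. Qed.

(** Off the diagonal exactly one of the two matrices has entry 1. On it both vanish while the
    maximum is at least v_i^2; these squares sum to the 1 subtracted. *)
Lemma rayleigh_complement (v w : 'I_N -> R) :
  \sum_i v i ^+ 2 = 1 -> \sum_i w i ^+ 2 = 1 ->
  rayleigh (adjmx R G) v + rayleigh (adjmx R (compl G)) w <= 4 / 3 * N%:R - 1.
Proof.
move=> v1 w1.
pose s := [seq (`|v i|, `|w i|) | i <- enum 'I_N].
have bigs (F : R * R -> R) : \sum_(p <- s) F p = \sum_i F (`|v i|, `|w i|).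
  by rewrite big_map big_enum.
have sqE (u : 'I_N -> R) : \sum_i `|u i| ^+ 2 = \sum_i u i ^+ 2.
  by apply: eq_bigr => i _; rewrite real_normK ?num_real.
have H : \sum_i \sum_j Num.max (`|v i| * `|v j|) (`|w i| * `|w j|) <=
    4 / 3 * N%:R.
  have := @max_form_bound _ s; rewrite size_map size_enum_ord.
  rewrite !(bigs (fun p => _ p ^+ 2)) /= !sqE => /(_ _ v1 w1).
  under [X in X <= _]eq_bigr do rewrite bigs.
  rewrite bigs; apply => p /mapP[i _ ->].
  by rewrite !normr_ge0.
rewrite lerBrDr (le_trans _ H)// -{1}v1 /rayleigh -!big_split /=.
apply: ler_sum => i _; rewrite -big_split /= (bigD1 i)//= [leRHS](bigD1 i)//=.
rewrite (@adjmx_diag G) (@adjmx_diag (compl G)) !mul0r !add0r addrC lerD//.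
  by rewrite le_max -normrM ler_norm -expr2.
apply: ler_sum => j ji; rewrite !mxE /= /compl_adj (inj_eq enum_val_inj).
rewrite eq_sym ji le_max -!normrM /=.
by case: adj; rewrite !(mul0r, mul1r, add0r, addr0) ler_norm ?orbT.
Qed.

(** Every eigenvalue is the value of the form at a normalised eigenvector. *)
Lemma sup_rayleigh (A : 'M[R]_N) (B : R) : (0 < N)%N -> (forall i, A i i = 0) ->
  (forall v, \sum_i v i ^+ 2 = 1 -> rayleigh A v <= B) ->
  sup [set a : R | eigenvalue A a]%classic <= B.
Proof.
move=> N0 A0 AB.
have [->|/set0P[a Aa]] :=
    eqVneq [set a : R | eigenvalue A a]%classic set0; last first.
  apply: ge_sup; first by exists a.
  move=> {}a {Aa} /= /eigenvalueP[v vA v_neq0].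
  have n0 : 0 < \sum_i v 0 i ^+ 2.
    rewrite lt_def sumr_ge0 ?andbT => [|i _]; last exact: sqr_ge0.
    apply: contra v_neq0; rewrite psumr_eq0 => [/allP v0|i _]; last exact: sqr_ge0.
    apply/eqP/rowP => i; rewrite mxE; apply/eqP; rewrite -sqrf_eq0.
    by apply: v0; rewrite mem_index_enum.
  set n := \sum_i _ in n0.
  have sE : Num.sqrt n ^+ 2 = n by rewrite sqr_sqrtr// ltW.
  have s0 : Num.sqrt n != 0 by rewrite -sqrf_eq0 sE lt0r_neq0.
  move: (Num.sqrt n) sE s0 => s sE s0.
  have := AB (fun i => v 0 i / s); rewrite /rayleigh.
  under eq_bigr do rewrite expr_div_n sE.
  rewrite -mulr_suml divff ?lt0r_neq0// => /(_ erefl); apply: le_trans.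
  rewrite -(mulfK (lt0r_neq0 n0) a) [a * n]mulr_sumr exchange_big /= mulr_suml.
  suff E j : \sum_i A i j * (v 0 i / s * (v 0 j / s)) =
      a * v 0 j ^+ 2 / n by under [leRHS]eq_bigr do rewrite E.
  have /rowP/(_ j) := vA; rewrite !mxE => aE.
  rewrite expr2 mulrA -aE -sE !mulr_suml; apply: eq_bigr => i _.
  by field.
(* For an empty set the supremum is 0, and 0 <= B because the form vanishes at a coordinate
   vector. *)
rewrite sup0; pose i0 : 'I_N := Ordinal N0.
apply: le_trans (AB (fun i => (i == i0)%:R) _).
  rewrite /rayleigh sumr_ge0// => i _; rewrite sumr_ge0// => j _.
  have [->|_] := eqVneq i i0; last by rewrite mul0r mulr0.
  by have [->|_] := eqVneq j i0; rewrite ?A0 ?mul0r// !mulr0.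
rewrite (bigD1 i0)// eqxx expr1n big1 => [|i /negbTE->]; last by rewrite expr0n.
exact: addr0.
Qed.

End Rayleigh.

Theorem theorem1 (R : realType) (n : nat) (G : sgraph)
    (n_gt0 : (0 < n)%N) (cardG : #|G| = n) :
  lambda1 R G + lambda1 R (compl G) <= 4 / 3 * n%:R - 1.
Proof.
move: n_gt0; rewrite -cardG => N_gt0.
rewrite -lerBrDr; apply: (sup_rayleigh N_gt0 (@adjmx_diag R G)) => v v1.
rewrite lerBrDr addrC -lerBrDr.
apply: (sup_rayleigh N_gt0 (@adjmx_diag R (compl G))) => w w1.
rewrite lerBrDr addrC; exact: rayleigh_complement.
Qed.
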